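(* Let $K$ be a connected Koszmider space. Then the algebra $\mathcal{B}(C(K,\mathbb{R}))$ of bounded linear operators on the real Banach space $C(K,\mathbb{R})$ is Dedekind-finite but it does not have stable rank one.
   Context: For a compact Hausdorff space $K$, $C(K,\mathbb{R})$ is the real Banach space of continuous real-valued functions on $K$ with the supremum norm, and $\mathcal{B}(C(K,\mathbb{R}))$ is the real unital Banach algebra of bounded linear operators on it. An operator $T$ on a Banach space $X$ is strictly singular if there is no infinite-dimensional subspace $Y$ of $X$ such that $T|_Y$ is an isomorphism onto its range; $\mathcal{S}(X)$ denotes the set of strictly singular operators on $X$. For $g\in C(K,\mathbb{R})$, the multiplication operator is $M_g\colon C(K,\mathbb{R})\to C(K,\mathbb{R})$, $f\mapsto fg$. An operator $T\in\mathcal{B}(C(K,\mathbb{R}))$ is a weak multiplication if there are $g\in C(K,\mathbb{R})$ and $S\in\mathcal{S}(C(K,\mathbb{R}))$ with $T=M_g+S$. A Koszmider space is an infinite compact Hausdorff space $K$ such that every bounded linear operator on $C(K,\mathbb{R})$ is a weak multiplication. Two idempotents $p,q$ in a ring $A$ are equivalent, $p\sim q$, if there are $a,b\in A$ with $ab=p$ and $ba=q$. A unital ring $A$ is Dedekind-finite if the only idempotent $p\in A$ with $p\sim 1_A$ is $p=1_A$. A unital (real or complex) Banach algebra $A$ has stable rank one if its group of invertible elements is norm-dense in $A$. *)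

(* Defs.v *)
From HB Require Import structures.
From mathcomp Require Import all_boot all_order all_algebra.
From mathcomp Require Import all_classical all_reals all_analysis.
From mathcomp Require Import ring lra.

Set Implicit Arguments.
Unset Strict Implicit.
Unset Printing Implicit Defensive.

Import Order.TTheory GRing.Theory Num.Theory.
Import numFieldNormedType.Exports.

Local Open Scope classical_set_scope.
Local Open Scope ring_scope.

HB.mixin Record isCompactHausdorff K & Topological K := {
  compact_setT : compact [set: K];
  compact_hausdorff : hausdorff_space K
}.

#[short(type="compactHausdorffType")]
HB.structure Definition CompactHausdorff :=
  {K of isCompactHausdorff K & Topological K}.

Definition idempotent_elt (A : pzRingType) (p : A) := p * p = p.

Definition idempotent_equiv (A : pzRingType) (p q : A) :=
  exists a b : A, a * b = p /\ b * a = q.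

Definition dedekind_finite (A : pzRingType) :=
  forall p : A, idempotent_elt p -> idempotent_equiv p 1 -> p = 1.

Definition invertible (A : pzRingType) (x : A) :=
  exists y : A, x * y = 1 /\ y * x = 1.

(* Norm-density of the invertible elements. Hierarchy-Builder does not accept a
   join of [pzRingType] and [normedModType], hence the explicit norm. *)
Definition stable_rank_one (R : realType) (A : pzRingType) (norm : A -> R) :=
  forall (x : A) (e : R), 0 < e ->
    exists y : A, invertible y /\ norm (x - y) < e.

Section complete_eval.
Context (R : realType) (V : normedModType R) (W : completeNormedModType R).
Context (I : Type) (ev : I -> V -> W) (C : I -> R).
Context (C_ge0 : forall i, 0 <= C i).
Context (evB : forall i u v, ev i (u - v) = ev i u - ev i v).
Context (ev_le : forall i u, `|ev i u| <= C i * `|u|).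
Context (norm_le_ev : forall u e, 0 <= e ->
  (forall i, `|ev i u| <= C i * e) -> `|u| <= e).
Context (ev_limit : forall l : I -> W,
  (forall e, 0 < e -> exists u, forall i, `|ev i u - l i| <= C i * e) ->
  exists v, forall i, ev i v = l i).

Lemma cauchy_cvg_eval (F : set_system V) : ProperFilter F -> cauchy F -> cvg F.
Proof.
move=> FF Fc.
have Fd e : 0 < e -> exists2 A, F A & forall u v, A u -> A v -> `|u - v| <= e.
  move=> e0; move/cauchy_ballP : (Fc) => /(_ e e0) [[A B]] /= [FA FB] AB.
  exists (A `&` B); first exact: filterI.
  move=> u v [Au _] [_ Bv]; apply/ltW.
  by have := AB (u, v) (conj Au Bv); rewrite -ball_normE.
have evd i u v e : `|u - v| <= e -> `|ev i u - ev i v| <= C i * e.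
  by move=> uv; rewrite -evB (le_trans (ev_le _ _))// ler_wpM2l.
have evc i : cvg (ev i @ F).
  apply: cauchy_cvg; apply/cauchy_ballP => e e0.
  have d0 : 0 < e / (C i + 1).
    by rewrite divr_gt0// (le_lt_trans (C_ge0 i))// ltrDl.
  have [A FA Ad] := Fd _ d0.
  have FA' : F (ev i @^-1` (ev i @` A)) by apply: filterS FA => u Au; exists u.
  exists (ev i @` A, ev i @` A) => //.
  move=> [_ _] /= [[u Au <-] [v Av <-]].
  rewrite -ball_normE /=; apply: (le_lt_trans (evd _ _ _ _ (Ad _ _ Au Av))).
  rewrite mulrCA -[ltRHS]mulr1 ltr_pM2l// ltr_pdivrMr ?mul1r ?ltrDl//.
  by rewrite (le_lt_trans (C_ge0 i))// ltrDl.
pose l i : W := lim (ev i @ F).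
have el e A : (forall u v, A u -> A v -> `|u - v| <= e) -> F A ->
    forall u i, A u -> `|ev i u - l i| <= C i * e.
  move=> Ad FA u i Au.
  have lc : (fun v => `|ev i u - ev i v|) @ F --> `|ev i u - l i|.
    by apply: cvg_norm; apply: cvgB; [exact: cvg_cst|exact: evc].
  rewrite -(cvg_lim (@Rhausdorff R) lc).
  apply: limr_le; first by apply/cvg_ex; eexists; exact: lc.
  by apply: (filterS _ FA) => v Av; exact/evd/Ad.
have [v vl] : exists v, forall i, ev i v = l i.
  apply: ev_limit => e e0; have [A FA Ad] := Fd _ e0.
  have [u Au] := filter_ex FA.
  by exists u => i; exact: el FA _ _ Au.
apply/cvg_ex; exists v; apply/cvgrPdist_le => e e0.
have [A FA Ad] := Fd _ e0; apply: (filterS _ FA) => u Au /=.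
rewrite distrC; apply: norm_le_ev; first exact: ltW.
by move=> i; rewrite evB vl; exact: el FA _ _ Au.
Qed.

End complete_eval.

Definition contfun (K : compactHausdorffType) (R : realType) :=
  continuousType K R.

Section contfun_theory.
Context (K : compactHausdorffType) (R : realType).
Notation T := (contfun K R).

HB.instance Definition _ := Choice.on T.

Definition contfun_pred : {pred K -> R} := mem [set f : K -> R | continuous f].

Definition contfun_Sub (f : K -> R) (Pf : f \in contfun_pred) : T :=
  mkcts (set_mem Pf : continuous f).

Lemma contfun_rect (P : T -> Type) :
  (forall f (Pf : f \in contfun_pred), P (contfun_Sub Pf)) -> forall u : T, P u.
Proof.
move=> PSub [f [[cf]]]; have Pf : f \in contfun_pred by rewrite inE.
have -> : cf = set_mem Pf by exact: Prop_irrelevance.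
exact: PSub.
Qed.

Lemma contfun_valP (f : K -> R) (Pf : f \in contfun_pred) :
  contfun_Sub Pf = f :> (K -> R).
Proof. by []. Qed.

HB.instance Definition _ := isSub.Build _ _ T contfun_rect contfun_valP.

Lemma contfunP (f g : T) : (forall x, f x = g x) -> f = g.
Proof. by move=> fg; apply/val_inj/funext. Qed.

Lemma contfun_continuous (f : T) : continuous f.
Proof. exact: cts_fun. Qed.

Lemma contfun_submod_closed : submod_closed contfun_pred.
Proof.
split; first by rewrite inE /= => x; exact: cvg_cst.
move=> a f g; rewrite !inE /= => cf cg x.
by apply: cvgD; [apply: cvgZr; exact: cf|exact: cg].
Qed.
HB.instance Definition _ :=
  GRing.isSubmodClosed.Build R (K -> R) contfun_pred contfun_submod_closed.
HB.instance Definition _ := [SubChoice_isSubLmodule of T by <:].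

Lemma contfunD (f g : T) x : (f + g) x = f x + g x. Proof. by []. Qed.
Lemma contfunB (f g : T) x : (f - g) x = f x - g x. Proof. by []. Qed.
Lemma contfunZ a (f : T) x : (a *: f) x = a * f x. Proof. by []. Qed.
Lemma contfun0 x : (0 : T) x = 0. Proof. by []. Qed.

Definition sup_norm (f : T) : R := sup (range (fun x => `|f x|)).

Lemma sup_norm_ubound (f : T) : has_ubound (range (fun x => `|f x|)).
Proof.
have cnf : continuous (fun x => `|f x|).
  by move=> x; apply: cvg_norm; exact: contfun_continuous.
have : compact (range (fun x => `|f x|)).
  apply: continuous_compact; last exact: compact_setT.
  by apply: continuous_subspaceT.
move=> /compact_bounded [M [_ /(_ (M + 1))]].
rewrite ltrDl ltr01 => /(_ isT) fM; exists (M + 1) => _ [x _ <-].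
by apply: le_trans (fM _ _); [exact: ler_norm|exists x].
Qed.

Lemma le_sup_norm (f : T) x : `|f x| <= sup_norm f.
Proof. by apply: (ub_le_sup (sup_norm_ubound f)); exists x. Qed.

Lemma sup_norm_le (f : T) e : 0 <= e -> (forall x, `|f x| <= e) ->
  sup_norm f <= e.
Proof.
move=> e0 fe; have [[x _]|K0] := pselect ([set: K] !=set0).
  apply: ge_sup; first by exists `|f x|, x.
  by move=> _ [y _ <-]; exact: fe.
rewrite /sup_norm; suff -> : range (fun x => `|f x|) = set0 by rewrite sup0.
by rewrite -subset0 => z [x _ _]; apply: K0; exists x.
Qed.

Lemma sup_norm_ge0 (f : T) : 0 <= sup_norm f.
Proof.
have [[x _]|K0] := pselect ([set: K] !=set0).
  exact: le_trans (normr_ge0 _) (le_sup_norm f x).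
rewrite /sup_norm; suff -> : range (fun x => `|f x|) = set0 by rewrite sup0.
by rewrite -subset0 => z [x _ _]; apply: K0; exists x.
Qed.

Let sup_normD (f g : T) : sup_norm (f + g) <= sup_norm f + sup_norm g.
Proof.
apply: sup_norm_le => [|x]; first by rewrite addr_ge0// sup_norm_ge0.
by rewrite (le_trans (ler_normD _ _))// lerD// le_sup_norm.
Qed.

Let sup_normZ (a : R) (f : T) : sup_norm (a *: f) = `|a| * sup_norm f.
Proof.
have le b (g : T) : sup_norm (b *: g) <= `|b| * sup_norm g.
  apply: sup_norm_le => [|x]; first by rewrite mulr_ge0// sup_norm_ge0.
  by rewrite contfunZ normrM ler_wpM2l// le_sup_norm.
have [->|a0] := eqVneq a 0.
  rewrite normr0 mul0r; apply/le_anti; rewrite sup_norm_ge0 andbT.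
  by apply: sup_norm_le => // x; rewrite contfunZ mul0r normr0.
apply/le_anti; rewrite le /=.
rewrite -ler_pdivlMl ?normr_gt0// -normfV.
by rewrite -{1}[f](scalerK a0); exact: le.
Qed.

Let sup_norm_eq0 (f : T) : sup_norm f = 0 -> f = 0.
Proof.
move=> f0; apply: contfunP => x; apply/eqP; rewrite -normr_le0 -f0.
exact: le_sup_norm.
Qed.

HB.instance Definition _ :=
  Lmodule_isNormed.Build R T sup_normD sup_normZ sup_norm_eq0.

Lemma contfun_normE (f : T) : `|f| = sup (range (fun x => `|f x|)).
Proof. by []. Qed.

Let contfun_complete (F : set_system T) : ProperFilter F -> cauchy F -> cvg F.
Proof.
apply: (@cauchy_cvg_eval R T R^o K (fun x f => f x) (fun=> 1)) => //.
- by move=> x f; rewrite mul1r; exact: le_sup_norm.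
- move=> f e e0 fe; apply: sup_norm_le => // x.
  by have := fe x; rewrite mul1r.
- move=> l ul; suff cl : continuous l.
    by exists (mkcts cl : continuousType K R).
  move=> x; apply/cvgrPdist_le => e e0.
  have [|f fl] := ul (e / 3); first by rewrite divr_gt0.
  have /cvgrPdist_le /(_ (e / 3)) := contfun_continuous (f := f) (x := x).
  rewrite divr_gt0// => /(_ isT); apply: filterS => y fxy.
  have := fl x; have := fl y; rewrite !mul1r => h1 h2.
  have -> : l x - l y = - (f x - l x) + (f x - f y) + (f y - l y) by ring.
  have -> : e = e / 3 + e / 3 + e / 3 by field.
  by rewrite (le_trans (ler_normD _ _))// lerD// (le_trans (ler_normD _ _))// lerD// normrN.
Qed.
HB.instance Definition _ := Uniform_isComplete.Build T contfun_complete.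

End contfun_theory.

Definition bounded_linear_pred (R : realType) (X : normedModType R) :
    {pred X -> X} :=
  mem [set T : X -> X |
    linear T /\ exists M : R, forall x, `|T x| <= M * `|x|].
Arguments bounded_linear_pred {R} X.

Record bounded_operator (R : realType) (X : normedModType R) := BoundedOperator {
  bop_fun :> X -> X;
  bop_funP : bop_fun \in bounded_linear_pred X
}.

Section bounded_operator_theory.
Context (R : realType) (X : normedModType R).
Notation B := (bounded_operator X).

HB.instance Definition _ := [isSub for @bop_fun R X].
HB.instance Definition _ := [Choice of B by <:].

Lemma bopP (S T : B) : (forall x, S x = T x) -> S = T.
Proof. by move=> ST; apply/val_inj/funext. Qed.

Lemma bop_linear (T : B) : linear T.
Proof. by have := bop_funP T; rewrite inE => -[]. Qed.

HB.instance Definition _ (T : B) := GRing.isLinear.Build R X X *:%R T (bop_linear T).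

Lemma bop_bounded (T : B) : exists M : R, forall x, `|T x| <= M * `|x|.
Proof. by have := bop_funP T; rewrite inE => -[]. Qed.

Lemma bop_boundedW (T : B) :
  exists2 M : R, 0 <= M & forall x, `|T x| <= M * `|x|.
Proof.
have [M TM] := bop_bounded T; exists `|M| => // x.
by rewrite (le_trans (TM x))// ler_wpM2r// ler_norm.
Qed.

Lemma bop_submod_closed : submod_closed (bounded_linear_pred X).
Proof.
split=> [|a S T]; rewrite !inE /=.
  split=> [b x y|]; first by rewrite scaler0 addr0.
  by exists 0 => x; rewrite mul0r normr0.
move=> [lS [M SM]] [lT [N TN]]; split=> [b x y|].
  rewrite !fctE /= lS lT !scalerDr !scalerA (mulrC a b) -!addrA; congr (_ + _).
  by rewrite addrCA.
exists (`|a| * M + N) => x; rewrite mulrDl (le_trans (ler_normD _ _))// lerD//.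
by rewrite normrZ -mulrA ler_wpM2l.
Qed.
HB.instance Definition _ :=
  GRing.isSubmodClosed.Build R (X -> X) (bounded_linear_pred X) bop_submod_closed.
HB.instance Definition _ := [SubChoice_isSubLmodule of B by <:].

Lemma bopD (S T : B) x : (S + T) x = S x + T x. Proof. by []. Qed.
Lemma bopB (S T : B) x : (S - T) x = S x - T x. Proof. by []. Qed.
Lemma bopZ a (T : B) x : (a *: T) x = a *: T x. Proof. by []. Qed.
Lemma bop0 x : (0 : B) x = 0. Proof. by []. Qed.

Let bop_id_subproof : @idfun X \in bounded_linear_pred X.
Proof. by rewrite inE; split=> //; exists 1 => x; rewrite mul1r. Qed.
Definition bop_id : B := BoundedOperator bop_id_subproof.

Let bop_comp_subproof (S T : B) : S \o T \in bounded_linear_pred X.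
Proof.
rewrite inE; split=> [a x y|]; first by rewrite /= !linearP.
have [M M0 SM] := bop_boundedW S; have [N N0 TN] := bop_boundedW T.
exists (M * N) => x; rewrite (le_trans (SM _))// -mulrA ler_wpM2l//.
Qed.
Definition bop_comp (S T : B) : B := BoundedOperator (bop_comp_subproof S T).

Let bop_compA : associative bop_comp. Proof. by move=> S T U; exact: bopP. Qed.
Let bop_comp1l : left_id bop_id bop_comp.
Proof. by move=> T; exact: bopP. Qed.
Let bop_comp1r : right_id bop_id bop_comp.
Proof. by move=> T; exact: bopP. Qed.
Let bop_compDl : left_distributive bop_comp +%R.
Proof. by move=> S T U; exact: bopP. Qed.
Let bop_compDr : right_distributive bop_comp +%R.
Proof. by move=> S T U; apply: bopP => x; exact: linearD. Qed.
HB.instance Definition _ := GRing.Zmodule_isPzRing.Build B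
  bop_compA bop_comp1l bop_comp1r bop_compDl bop_compDr.

Lemma bop1 x : (1 : B) x = x. Proof. by []. Qed.
Lemma bopM (S T : B) x : (S * T) x = S (T x). Proof. by []. Qed.

Definition op_norm (T : B) : R := sup [set `|T x| | x in [set x | `|x| <= 1]].

Lemma op_norm_ubound (T : B) :
  has_ubound [set `|T x| | x in [set x | `|x| <= 1]].
Proof.
have [M M0 TM] := bop_boundedW T; exists M => _ [x /= x1 <-].
by rewrite (le_trans (TM x))// -[leRHS]mulr1 ler_wpM2l.
Qed.

Lemma op_norm_ge0 (T : B) : 0 <= op_norm T.
Proof.
by apply: (ub_le_sup (op_norm_ubound T)); exists 0; rewrite /= ?linear0 normr0.
Qed.

Lemma le_op_norm (T : B) x : `|T x| <= op_norm T * `|x|.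
Proof.
have [->|x0] := eqVneq x 0; first by rewrite linear0 !normr0 mulr0.
have nx : 0 < `|x| by rewrite normr_gt0.
have : `|T (`|x|^-1 *: x)| <= op_norm T.
  apply: (ub_le_sup (op_norm_ubound T)); exists (`|x|^-1 *: x) => //=.
  by rewrite normrZ normfV normr_id mulVf ?normr_eq0.
by rewrite linearZ normrZ normfV normr_id mulrC ler_pdivrMr.
Qed.

Lemma op_norm_le (T : B) M : 0 <= M -> (forall x, `|T x| <= M * `|x|) ->
  op_norm T <= M.
Proof.
move=> M0 TM; apply: ge_sup => [|_ [x /= x1 <-]].
  by exists `|T 0|, 0; rewrite //= normr0.
by rewrite (le_trans (TM x))// -[leRHS]mulr1 ler_wpM2l.
Qed.

Let op_normD (S T : B) : op_norm (S + T) <= op_norm S + op_norm T.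
Proof.
apply: op_norm_le => [|x]; first by rewrite addr_ge0// op_norm_ge0.
by rewrite mulrDl (le_trans (ler_normD _ _))// lerD// le_op_norm.
Qed.

Let op_normZ (a : R) (T : B) : op_norm (a *: T) = `|a| * op_norm T.
Proof.
have le b (S : B) : op_norm (b *: S) <= `|b| * op_norm S.
  apply: op_norm_le => [|x]; first by rewrite mulr_ge0// op_norm_ge0.
  by rewrite bopZ normrZ -mulrA ler_wpM2l// le_op_norm.
have [->|a0] := eqVneq a 0.
  rewrite normr0 mul0r; apply/le_anti; rewrite op_norm_ge0 andbT.
  by apply: op_norm_le => // x; rewrite bopZ scale0r normr0 mul0r.
apply/le_anti; rewrite le /=.
rewrite -ler_pdivlMl ?normr_gt0// -normfV.
by rewrite -{1}[T](scalerK a0); exact: le.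
Qed.

Let op_norm_eq0 (T : B) : op_norm T = 0 -> T = 0.
Proof.
move=> T0; apply: bopP => x; apply/eqP; rewrite -normr_le0.
by rewrite (le_trans (le_op_norm T x))// T0 mul0r.
Qed.

HB.instance Definition _ :=
  Lmodule_isNormed.Build R B op_normD op_normZ op_norm_eq0.

Lemma bop_normE (T : B) : `|T| = sup [set `|T x| | x in [set x | `|x| <= 1]].
Proof. by []. Qed.

Lemma bop_normM (S T : B) : `|S * T| <= `|S| * `|T|.
Proof.
apply: op_norm_le => [|x]; first by rewrite mulr_ge0// op_norm_ge0.
rewrite bopM (le_trans (le_op_norm _ _))// -mulrA ler_wpM2l ?op_norm_ge0//.
exact: le_op_norm.
Qed.

Lemma bop_scalerAl (a : R) (S T : B) : a *: (S * T) = (a *: S) * T.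
Proof. by apply: bopP. Qed.

Lemma bop_scalerAr (a : R) (S T : B) : a *: (S * T) = S * (a *: T).
Proof. by apply: bopP => x; rewrite bopZ !bopM bopZ linearZ. Qed.

End bounded_operator_theory.

Section bounded_operator_complete.
Context (R : realType) (X : completeNormedModType R).
Notation B := (bounded_operator X).

Let bop_complete (F : set_system B) : ProperFilter F -> cauchy F -> cvg F.
Proof.
apply: (@cauchy_cvg_eval R B X X (fun x T => T x) (fun x => `|x|)) => //.
- by move=> x T; rewrite mulrC; exact: le_op_norm.
- move=> T e e0 Te; apply: op_norm_le => // x.
  by rewrite mulrC; exact: Te.
- move=> l ul; suff lP : l \in bounded_linear_pred X by exists (BoundedOperator lP).
  rewrite inE; split=> [a x y|]; last first.
    have [T Tl] := ul 1 ltr01; have [M M0 TM] := bop_boundedW T.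
    exists (M + 1) => x; rewrite -(subrK (T x) (l x)) addrC mulrDl mul1r.
    rewrite (le_trans (ler_normD _ _))// lerD// distrC.
    by have := Tl x; rewrite mulr1.
  apply/eqP; rewrite -subr_eq0 -normr_le0; apply/ler_addgt0Pl => e e0.
  rewrite addr0.
  pose c := `|a *: x + y| + (`|a| * `|x| + `|y|) + 1.
  have c0 : 0 < c by rewrite ltr_wpDl// !addr_ge0// mulr_ge0.
  have [|T Tl] := ul (e / c); first by rewrite divr_gt0.
  have -> : l (a *: x + y) - (a *: l x + l y) =
      - (T (a *: x + y) - l (a *: x + y)) + (a *: (T x - l x) + (T y - l y)).
    by rewrite (bop_linear T) scalerBr opprB [X in _ = _ + X]addrACA -opprD addrA subrK.
  apply: (@le_trans _ _ ((c - 1) * (e / c))).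
    rewrite /c addrK !mulrDl (le_trans (ler_normD _ _))// lerD//.
      by rewrite normrN.
    by rewrite (le_trans (ler_normD _ _))// lerD// normrZ -mulrA ler_wpM2l.
  rewrite [leRHS](_ : e = c * (e / c)); last by rewrite mulrCA divff ?mulr1// gt_eqF.
  by rewrite ler_wpM2r ?divr_ge0 ?ltW// ltrBlDr ltrDl.
Qed.
HB.instance Definition _ := Uniform_isComplete.Build B bop_complete.

End bounded_operator_complete.

(* [submodClosed X] is the type of linear subspaces of X. They need not be
   closed: a T bounded below on Y is bounded below on its closure. *)
Definition finite_dimensional (R : realType) (X : normedModType R)
    (Y : submodClosed X) :=
  exists (n : nat) (e : 'I_n -> X), (forall i, e i \in Y) /\
    forall y, y \in Y -> exists c : 'I_n -> R, y = \sum_(i < n) c i *: e i.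

(* S is the inverse of the restriction of T to Y; it is linear on the range
   because T is, so only its continuity there has to be required. *)
Definition isomorphism_onto_range (R : realType) (X : normedModType R)
    (T : bounded_operator X) (Y : submodClosed X) :=
  exists S : X -> X, {in Y, cancel T S} /\ {within T @` [set` Y], continuous S}.

Definition strictly_singular (R : realType) (X : normedModType R)
    (T : bounded_operator X) :=
  ~ exists Y : submodClosed X,
      ~ finite_dimensional Y /\ isomorphism_onto_range T Y.

Section koszmider.
Context (K : compactHausdorffType) (R : realType).
Notation C := (contfun K R).

Let contfun_mul_subproof (f g : C) : continuous (fun x => f x * g x).
Proof. by move=> x; apply: cvgM; exact: contfun_continuous. Qed.
Definition contfun_mul (f g : C) : C := mkcts (@contfun_mul_subproof f g).

Let mult_op_subproof (g : C) : contfun_mul^~ g \in bounded_linear_pred C.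
Proof.
rewrite inE; split=> [a f1 f2|].
  apply: contfunP => x; rewrite contfunD contfunZ.
  by rewrite -[LHS]/((a * f1 x + f2 x) * g x) mulrDl -mulrA.
exists `|g| => f; apply: sup_norm_le => [|x]; first by rewrite mulr_ge0.
rewrite normrM mulrC ler_pM//; exact: le_sup_norm.
Qed.
Definition mult_op (g : C) : bounded_operator C :=
  BoundedOperator (mult_op_subproof g).

Lemma mult_opE (g f : C) x : mult_op g f x = f x * g x. Proof. by []. Qed.

Definition weak_multiplication (T : bounded_operator C) :=
  exists (g : C) (S : bounded_operator C),
    strictly_singular S /\ T = mult_op g + S.

Definition koszmider_space :=
  infinite_set [set: K] /\ forall T : bounded_operator C, weak_multiplication T.

End koszmider.
Arguments koszmider_space : clear implicits.

(* Main.v *)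
Require Import Defs.
From HB Require Import structures.
From mathcomp Require Import all_boot all_order all_algebra.
From mathcomp Require Import all_classical all_reals all_analysis.
From mathcomp Require Import ring lra.
Import Order.TTheory GRing.Theory Num.Theory.
Import numFieldNormedType.Exports.

Set Implicit Arguments.
Unset Strict Implicit.
Unset Printing Implicit Defensive.

Local Open Scope classical_set_scope.
Local Open Scope ring_scope.

(** Write X for C(K). If U is a nonempty open set, the functions supported in U
    form an infinite-dimensional space, because a connected infinite K has no
    isolated points. On such a space M_k is small when k is small on U, and
    bounded below when k is large on U; comparing with a strictly singular S,
    which is bounded below on no infinite-dimensional subspace, gives
    - if M_h + S is bounded below by c, then |h| >= c everywhere
      ([bounded_below_mult_op_unit]);
    - |k| <= |M_k - S| everywhere ([mult_op_quotient_norm]).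

    The failure of stable rank one follows. Take g with values 1 and -1 at two
    points. An invertible operator within 1/2 of M_g is M_h + S with h zero-free
    and |g - h| < 1/2 pointwise, so h changes sign, and connectedness of K
    gives h a zero.

    For Dedekind-finiteness let b a = 1 and a = M_g + S. Then a is bounded
    below, hence g is zero-free, and the point is that a is surjective. This is
    the index argument: a is joined to the invertible operator M_g by the path
    M_g + t S, all of whose members are Fredholm, so a has index 0, and an
    injective operator of index 0 is onto. Here index 0 means being a finite-rank
    perturbation of an isomorphism.
    - Every M_g + t S is bounded below on the functions vanishing at some
      finite set of points ([singular_perturbation_semi_fredholm]). Otherwise a
      triangular sequence of almost-kernel vectors spans an
      infinite-dimensional space on which M_g + t S is tiny, so that S is bounded
      below there ([ex_almost_kernel]). The norming functionals in that
      construction are point evaluations.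
    - Index 0 is a locally constant property near an operator that is bounded
      below on such a finite-codimensional space
      ([fredholm_index0_locally_constant]). The key is that an operator of index
      0 can be corrected by a finite-rank operator to one bounded below
      by a constant that depends only on the lower bound on that space
      ([bounded_below_finite_rank]).
    Connectedness of the real line carries index 0 from t = 0 to t = 1. *)

(** * Subspaces and operators bounded below *)

Section subspaces.
Context (R : realType) (X : normedModType R).

Definition linear_subspace (P : set X) :=
  P 0 /\ forall a u v, P u -> P v -> P (a *: u + v).

Section subspace_of_set.
Context (P : set X) (P_sub : linear_subspace P).

Definition set_subspace of linear_subspace P : {pred X} := mem P.

Let set_subspace_closed : submod_closed (set_subspace P_sub).
Proof.
by have [P0 PD] := P_sub; split=> [|a u v]; rewrite !inE; [exact: P0|exact: PD].
Qed.

HB.instance Definition _ :=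
  GRing.isSubmodClosed.Build R X (set_subspace P_sub) set_subspace_closed.

(** Turns a set closed under linear combinations into an element of the
    structure over which strict singularity quantifies. *)
Lemma ex_subspace : exists Y : submodClosed X, forall f, f \in Y <-> P f.
Proof. by exists (set_subspace P_sub : submodClosed X) => f; rewrite inE. Qed.

End subspace_of_set.

Definition bounded_below (Y : set X) (c : R) (A : bounded_operator X) :=
  0 < c /\ forall f, Y f -> c * `|f| <= `|A f|.

Lemma bounded_below_inj (A : bounded_operator X) c :
  bounded_below setT c A -> forall f, A f = 0 -> f = 0.
Proof.
move=> [c0 Ac] f f0; apply/eqP; rewrite -normr_le0 -(pmulr_rle0 _ c0).
by rewrite (le_trans (Ac f I))// f0 normr0.
Qed.

(** The inverse on the range is Lipschitz with constant 1/c. *)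
Lemma bounded_below_iso (A : bounded_operator X) (Y : submodClosed X) c :
  bounded_below [set` Y] c A -> isomorphism_onto_range A Y.
Proof.
move=> [c0 Ac].
have Alip f g : f \in Y -> g \in Y -> c * `|f - g| <= `|A f - A g|.
  by move=> Yf Yg; rewrite -linearB; apply: Ac => /=; rewrite -scaleN1r rpredD ?rpredZ.
pose S g := get [set f | f \in Y /\ A f = g].
have SP f : f \in Y -> S (A f) \in Y /\ A (S (A f)) = A f.
  move=> Yf; have : [set h | h \in Y /\ A h = A f] !=set0 by exists f.
  exact: getPex.
have SK : {in Y, cancel A S}.
  move=> f Yf; have [Yh Ah] := SP f Yf.
  apply/eqP; rewrite -subr_eq0 -normr_le0 -(pmulr_rle0 _ c0).
  by rewrite (le_trans (Alip _ _ Yh Yf))// Ah subrr normr0.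
exists S; split=> //.
apply/subspace_continuousP => _ [f Yf <-].
apply/cvgrPdist_le => e e0; rewrite near_withinE.
have ce0 : 0 < c * e by rewrite mulr_gt0.
near=> g => -[h Yh hg].
rewrite -[leLHS]/`|S (A f) - S g| -hg !SK// -(ler_pM2l c0).
rewrite (le_trans (Alip _ _ Yf Yh))// hg; near: g.
exact: (@cvgr_dist_le _ _ _ _ _ id (A f)).
Unshelve. all: by end_near. Qed.

End subspaces.

(** The coordinates of n + 1 vectors of an n-generated space form a matrix
    with a nonzero left kernel. *)
Lemma independent_infinite_dimensional (R : realType) (X : normedModType R)
    (Y : submodClosed X) (x : nat -> X) : (forall k, x k \in Y) ->
  (forall n (a : 'I_n -> R), \sum_(k < n) a k *: x k = 0 ->
    forall k, a k = 0) ->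
  ~ finite_dimensional Y.
Proof.
move=> Yx free [n [e [_ Ye]]].
have /choice[c xE] : forall k, exists c : 'I_n -> R, x k = \sum_i c i *: e i.
  by move=> k; exact: Ye.
pose C := \matrix_(k < n.+1, i < n) c k i.
(* n.+1 rows and n columns: the left kernel is nonzero. *)
have : kermx C != 0.
  by rewrite kermx_eq0 /row_free neq_ltn ltnS rank_leq_col.
move=> /rowV0Pn[v /sub_kermxP vC /negP]; apply; apply/eqP/rowP => k.
rewrite mxE; apply: (free _ (v 0)) => /=.
transitivity (\sum_i (v *m C) 0 i *: e i).
  under eq_bigr do rewrite xE scaler_sumr.
  rewrite exchange_big/=; apply: eq_bigr => i _.
  by rewrite mxE scaler_suml; apply: eq_bigr => j _; rewrite scalerA mxE.
by rewrite vC big1// => i _; rewrite mxE scale0r.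
Qed.

(** * Triangular sequences *)

Section evaluations.
Context (K : compactHausdorffType) (R : realType).
Notation X := (contfun K R).

Lemma contfun_sum n (F : 'I_n -> X) z : (\sum_i F i) z = \sum_i F i z.
Proof. by apply: (big_morph (fun f : X => f z)). Qed.

Lemma contfun_le_norm (f : X) z : `|f z| <= `|f|.
Proof. exact: le_sup_norm. Qed.

Lemma contfun_norm_le (f : X) e : 0 <= e -> (forall z, `|f z| <= e) ->
  `|f| <= e.
Proof. exact: sup_norm_le. Qed.

Lemma ex_norming_point (f : X) : f != 0 -> exists z, `|f| <= 2 * `|f z|.
Proof.
rewrite -normr_gt0 => f0; apply: contrapT => /forallNP fz.
suff : `|f| <= `|f| / 2 by move=> ?; lra.
apply: contfun_norm_le => [|z]; first by rewrite divr_ge0 ?ltW.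
by have /negP := fz z; rewrite -ltNge => ?; lra.
Qed.

Definition vanishing (F : seq K) : set X := [set f | {in F, forall z, f z = 0}].

(** Up to scaling, the evaluations at the z k and the vectors x k form a
    triangular system with bounded coefficients; it plays the role of a basic
    sequence. *)
Definition triangular (x : nat -> X) (z : nat -> K) :=
  (forall k, x k != 0 /\ `|x k| <= 2 * `|x k (z k)|) /\
  forall j k, (j < k)%N -> x k (z j) = 0.

(** Choose x k among the functions vanishing at z 0, ..., z (k - 1), then let
    z k be a point where x k is at least half its norm. *)
Lemma ex_triangular (Q : nat -> set X) :
  (forall k F, exists f, [/\ f != 0, vanishing F f & Q k f]) ->
  exists x z, triangular x z /\ forall k, Q k (x k).
Proof.
move=> ex.
have /choice[w wP] : forall p : nat * seq K, exists fz : X * K,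
    [/\ fz.1 != 0, vanishing p.2 fz.1, Q p.1 fz.1 & `|fz.1| <= 2 * `|fz.1 fz.2|].
  move=> [k F]; have [f [f0 Ff Qf]] := ex k F.
  by have [z fz] := ex_norming_point f0; exists (f, z).
pose pts := fix pts n := if n is m.+1 then (w (m, pts m)).2 :: pts m else [::].
pose x n := (w (n, pts n)).1; pose z n := (w (n, pts n)).2.
have pts_z j k : (j < k)%N -> z j \in pts k.
  elim: k => // k IH; rewrite ltnS leq_eqVlt inE => /predU1P[->|/IH ->].
    by rewrite eqxx.
  by rewrite orbT.
exists x, z; split=> [|k]; last by have [] := wP (k, pts k).
split=> [k|j k jk]; have [x0 xF _ xz] := wP (k, pts k) => //.
exact/xF/pts_z.
Qed.

(** Forward substitution: evaluating at z j expresses the j-th coefficient by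
    the value there and the earlier coefficients, and
    1 + \sum_(k < j) 2 * 3 ^ k = 3 ^ j. *)
Lemma triangular_coef x z n (a : 'I_n -> R) (j : 'I_n) : triangular x z ->
  `|a j| * `|x j| <= 2 * 3 ^+ j * `|\sum_(k < n) a k *: x k|.
Proof.
move=> [x2 x0]; set f := \sum_(k < n) _.
elim/ltn_ind: {j}(j : nat) {-2}j (erefl (j : nat)) => m IH j jm.
have fE : f (z j) = a j * x j (z j) + \sum_(k < n | (k < j)%N) a k * x k (z j).
  rewrite contfun_sum (bigID (fun k : 'I_n => (k < j)%N))/= addrC.
  rewrite (bigD1 j) ?ltnn//= [X in _ + X + _]big1 ?addr0// => k.
  rewrite -leqNgt => /andP[jk kj]; rewrite contfunZ x0 ?mulr0//.
  by rewrite ltn_neqAle jk andbT eq_sym.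
have sum_le : `|\sum_(k < n | (k < j)%N) a k * x k (z j)| <=
    (\sum_(k < n | (k < j)%N) 2 * 3 ^+ k) * `|f|.
  rewrite mulr_suml (le_trans (ler_norm_sum _ _ _))//.
  apply: ler_sum => k kj; rewrite (le_trans _ (IH k _ k _)) -?jm//.
  by rewrite normrM ler_wpM2l// contfun_le_norm.
have sumE : 1 + \sum_(k < n | (k < j)%N) 2 * 3 ^+ k = 3 ^+ j :> R.
  rewrite -(big_ord_widen _ (fun k => 2 * 3 ^+ k)) 1?ltnW//.
  elim: (j : nat) => [|i IHi]; first by rewrite big_ord0 addr0 expr0.
  by rewrite big_ord_recr/= addrA IHi exprS; ring.
have ajz : `|a j| * `|x j (z j)| <= 3 ^+ j * `|f|.
  have -> : `|a j| * `|x j (z j)| =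
      `|f (z j) - \sum_(k < n | (k < j)%N) a k * x k (z j)|.
    by rewrite fE addrK normrM.
  rewrite -sumE mulrDl mul1r (le_trans (ler_normB _ _))// lerD//.
  exact: contfun_le_norm.
have [_ xj] := x2 j.
rewrite -mulrA (le_trans _ (ler_wpM2l _ ajz))//.
by rewrite mulrCA ler_wpM2l.
Qed.

Lemma triangular_free x z n (a : 'I_n -> R) : triangular x z ->
  \sum_(k < n) a k *: x k = 0 -> forall k, a k = 0.
Proof.
move=> txz sum0 k; have := triangular_coef a k txz.
rewrite sum0 normr0 mulr0 -normrZ normr_le0 scaler_eq0.
by have [/(_ k)[/negPf -> _] _] := txz; rewrite orbF => /eqP.
Qed.

Lemma vanishing_infinite_dimensional (Y : submodClosed X) :
  (forall F, exists2 f, f \in Y & f != 0 /\ vanishing F f) ->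
  ~ finite_dimensional Y.
Proof.
move=> YF; have [|x [z [txz Yx]]] := ex_triangular (Q := fun=> [set` Y]).
  by move=> _ F; have [f Yf [f0 Ff]] := YF F; exists f.
apply: (independent_infinite_dimensional Yx) => n a.
exact: triangular_free txz.
Qed.

(** If A is bounded below on no space of finite codimension cut out by
    evaluations, there is a triangular sequence with |A (x k)| <= eps k * |x k|
    for eps k decreasing fast enough to absorb the growth of the coefficients in
    [triangular_coef]. *)
Lemma ex_almost_kernel (A : bounded_operator X) (e : R) : 0 < e ->
  (forall F c, ~ bounded_below (vanishing F) c A) ->
  exists Y : submodClosed X, ~ finite_dimensional Y /\
    forall f, f \in Y -> `|A f| <= e * `|f|.
Proof.
move=> e0 nbb; pose eps k := e / (4 * 6 ^+ k).
have eps0 k : 0 < eps k by rewrite divr_gt0// mulr_gt0// exprn_gt0.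
have [|x [z [txz xe]]] :=
    ex_triangular (Q := fun k => [set f | `|A f| <= eps k * `|f|]).
  move=> k F; apply: contrapT => /forallNP nf; apply: (nbb F (eps k)).
  split=> // f Ff; rewrite leNgt; apply/negP => Af; apply: (nf f).
  split=> //=; last exact: ltW.
  by apply: contraTneq Af => ->; rewrite linear0 !normr0 mulr0 ltxx.
(* The span of x; requiring the identity for all large n lets two
   combinations be added without aligning their lengths. *)
pose P f := exists a : nat -> R, exists N, forall n, (N <= n)%N ->
  f = \sum_(k < n) a k *: x k.
have [|Y YP] := @ex_subspace R X P; first split.
- by exists (fun=> 0), 0%N => n _; rewrite big1// => k _; rewrite scale0r.
- move=> c f g [a [N fE]] [b [M gE]].
  exists (fun k => c * a k + b k), (maxn N M) => n; rewrite geq_max => /andP[Nn Mn].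
  rewrite (fE n)// (gE n)// scaler_sumr -big_split/=; apply: eq_bigr => k _.
  by rewrite scalerDl scalerA.
exists Y; split.
  apply: (@independent_infinite_dimensional _ _ _ x).
    move=> k; apply/YP; exists (fun i => (i == k)%:R), k.+1 => n kn.
    rewrite (bigD1 (Ordinal kn))//= eqxx scale1r big1 ?addr0// => i.
    by rewrite -val_eqE/= => /negPf ->; rewrite scale0r.
  by move=> n a; exact: triangular_free txz.
move=> f /YP[a [n /(_ n (leqnn n)) fE]].
have term (k : 'I_n) : `|a k| * `|A (x k)| <= e * `|f| * (2^-1 ^+ k / 2).
  have := triangular_coef (fun i => a i) k txz; rewrite -fE => ak.
  rewrite (le_trans (ler_wpM2l _ (xe k)))// mulrCA.
  rewrite (le_trans (ler_wpM2l _ ak)) ?(ltW (eps0 k))//.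
  (* 4 * 6 ^ k cancels the bound 2 * 3 ^ k and leaves the summable 2 ^- k.+1. *)
  rewrite /eps (_ : 6 = 3 * 2 :> R); last by ring.
  rewrite exprMn exprVn le_eqVlt; apply/orP; left; apply/eqP; field.
  by rewrite !expf_neq0// pnatr_eq0.
have geo m : \sum_(k < m) 2^-1 ^+ k / 2 = 1 - 2^-1 ^+ m :> R.
  elim: m => [|m IH]; first by rewrite big_ord0 expr0 subrr.
  by rewrite big_ord_recr/= IH exprS; field.
rewrite {1}fE linear_sum (le_trans (ler_norm_sum _ _ _))//.
apply: (@le_trans _ _ (\sum_(k < n) e * `|f| * (2^-1 ^+ k / 2))).
  by apply: ler_sum => k _; rewrite linearZ normrZ.
rewrite -mulr_sumr geo -[leRHS]mulr1 ler_wpM2l//.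
by rewrite mulr_ge0// ltW.
Qed.

End evaluations.

(** * Strictly singular perturbations of multiplication operators *)

Section supports.
Context (K : compactHausdorffType) (R : realType).
Notation X := (contfun K R).

Lemma finite_closed (A : set K) : finite_set A -> closed A.
Proof.
apply: (proj1 (@accessible_finite_set_closed K)).
exact/hausdorff_accessible/compact_hausdorff.
Qed.

Lemma ex_contfun_separating (A : set K) p : closed A -> ~ A p ->
  exists f : X, f p = 1 /\ forall q, A q -> f q = 0.
Proof.
move=> clA Ap.
have nK : normal_space K.
  exact: compact_normal (@compact_hausdorff K) (@compact_setT K).
have cp : closed [set p] by exact: finite_closed.
have [|f [cf f0 f1 _]] := urysohn_ext_itv nK clA cp _ (@ltr01 R).
  by apply/seteqP; split=> // q [Aq /= qp]; apply: Ap; rewrite -qp.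
exists (mkcts cf : continuousType K R); split=> [|q Aq].
  by apply: f1; exists p.
by apply: f0; exists q.
Qed.

Context (K_connected : connected [set: K]).
Context (K_infinite : infinite_set [set: K]).

(** A finite nonempty open set would make a point clopen, hence all of K. *)
Lemma open_not_finite (U : set K) (F : seq K) : open U -> U !=set0 ->
  exists2 p, U p & p \notin F.
Proof.
move=> oU [p Up]; apply: contrapT => UF; apply: K_infinite.
suff <- : [set p] = [set: K] by exact: finite_set1.
apply: K_connected; first by exists p.
  exists (U `&` ~` ([set` F] `\ p)).
    apply: openI => //; apply: closed_openC; apply: finite_closed.
    exact: finite_setD (finite_seq F).
  rewrite setTI; apply/seteqP; split=> [q -> /=|q [Uq /= Fq]]; first by split=> // -[].
  apply: contrapT => qp; apply: Fq; split=> //.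
  by apply: contrapT => /negP qF; apply: UF; exists q.
by exists [set p]; [exact: finite_closed|rewrite setTI].
Qed.

Lemma ex_supported_subspace (U : set K) : open U -> U !=set0 ->
  exists Y : submodClosed X, ~ finite_dimensional Y /\
    forall f, f \in Y -> forall p, ~ U p -> f p = 0.
Proof.
move=> oU U0.
have [|Y YP] := @ex_subspace R X [set f | forall p, ~ U p -> f p = 0].
  split.
  - by move=> p _.
  - by move=> a f g f0 g0 p Up; rewrite contfunD contfunZ f0// g0// mulr0 addr0.
exists Y; split; last by move=> f /YP.
apply: vanishing_infinite_dimensional => F.
have [p Up pF] := open_not_finite F oU U0.
have [||f [fp f0]] := @ex_contfun_separating (~` U `|` [set` F]) p.
- by apply: closedU; [exact: open_closedC|exact: finite_closed].
- by case=> // /(negP pF).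
exists f; first by apply/YP => q Uq; apply: f0; left.
split; last by move=> q qF; apply: f0; right.
apply/eqP => f00; have : f p = 0 by rewrite f00.
by rewrite fp => /eqP; rewrite oner_eq0.
Qed.

(** If |h p| < d < c, then M_h has norm at most d on the functions supported
    in {|h| < d}, so S is bounded below by c - d there. *)
Lemma bounded_below_mult_op_unit (h : X) (S : bounded_operator X) c :
  strictly_singular S -> bounded_below setT c (mult_op h + S) ->
  forall p, c <= `|h p|.
Proof.
move=> Sss [c0 hS] p; rewrite leNgt; apply/negP => hp; apply: Sss.
pose d := (`|h p| + c) / 2.
have [||Y [Yinf Ysupp]] := @ex_supported_subspace [set q | `|h q| < d].
- apply: (@open_comp _ _ (fun q => `|h q|) [set y | y < d]); last exact: open_lt.
  by move=> q _; apply: cvg_norm; exact: contfun_continuous.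
- by exists p => /=; rewrite /d; lra.
exists Y; split=> //; apply: (@bounded_below_iso _ _ _ _ (c - d)).
split=> [|f Yf]; first by rewrite /d; lra.
have hf : `|mult_op h f| <= d * `|f|.
  apply: contfun_norm_le => [|q]; first by rewrite mulr_ge0// /d; have := normr_ge0 (h p); lra.
  rewrite mult_opE normrM mulrC.
  have [hq|hq] := pselect (`|h q| < d).
    by apply: ler_pM => //; [exact: ltW|exact: contfun_le_norm].
  by rewrite (Ysupp f Yf q hq) normr0 mulr0 mulr_ge0// /d; have := normr_ge0 (h p); lra.
have := hS f I; rewrite bopD => cf.
have := ler_normD (mult_op h f) (S f).
rewrite mulrBl; lra.
Qed.

(** The norm of k is at most the distance from M_k to the strictly singular
    operators: if |M_k - S| < d < |k p|, then S is bounded below by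
    d - |M_k - S| on the functions supported in {d < |k|}. *)
Lemma mult_op_quotient_norm (k : X) (S : bounded_operator X) :
  strictly_singular S -> forall p, `|k p| <= `|mult_op k - S|.
Proof.
move=> Sss p; set e := `|mult_op k - S|; rewrite leNgt; apply/negP => kp; apply: Sss.
pose d := (`|k p| + e) / 2.
have [||Y [Yinf Ysupp]] := @ex_supported_subspace [set q | d < `|k q|].
- apply: (@open_comp _ _ (fun q => `|k q|) [set y | d < y]); last exact: open_gt.
  by move=> q _; apply: cvg_norm; exact: contfun_continuous.
- by exists p => /=; rewrite /d; lra.
exists Y; split=> //; apply: (@bounded_below_iso _ _ _ _ (d - e)).
split=> [|f Yf]; first by rewrite /d; lra.
have d0 : 0 < d by rewrite /d; have := normr_ge0 (mult_op k - S); rewrite -/e; lra.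
have kf : d * `|f| <= `|mult_op k f|.
  rewrite -ler_pdivlMl//; apply: contfun_norm_le => [|q].
    by rewrite mulr_ge0// invr_ge0 ltW.
  rewrite ler_pdivlMl//; have [kq|kq] := pselect (d < `|k q|).
    apply: le_trans (contfun_le_norm _ q).
    by rewrite mult_opE normrM mulrC ler_wpM2l// ltW.
  by rewrite (Ysupp f Yf q kq) normr0 mulr0.
have := le_op_norm (mult_op k - S) f; rewrite -[op_norm _]/e bopB => ef.
have := ler_normD (mult_op k f - S f) (S f); rewrite subrK.
rewrite mulrBl; lra.
Qed.

End supports.

(** * Operators with closed range and their perturbations *)

Section closed_range.
Context (R : realType) (X : completeNormedModType R).
Implicit Types (G U T : bounded_operator X) (V : set X).

(** The approximate solutions in V of G v = x form a Cauchy filter, whose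
    limit would be an exact solution if they were arbitrarily good. *)
Lemma closed_range_gap G V c x : closed V -> linear_subspace V ->
  bounded_below V c G -> (forall v, V v -> G v <> x) ->
  exists2 d, 0 < d & forall v, V v -> d <= `|x - G v|.
Proof.
move=> clV [V0 VD] [c0 Gc] nx; apply: contrapT => /forall2NP nd.
have ex e : 0 < e -> exists2 v, V v & `|x - G v| < e.
  move=> e0; have [//|/existsNP[v /not_implyP[Vv /negP]]] := nd e.
  by rewrite -ltNge; exists v.
pose near_x e := [set v | V v /\ `|x - G v| < e].
pose F := filter_from [set e : R | 0 < e] near_x.
have FF : ProperFilter F.
  apply: filter_from_proper; last by move=> e /ex[v]; exists v.
  apply: filter_from_filter; first by exists 1 => /=.
  move=> e d /= e0 d0; exists (Order.min e d); first by rewrite /= lt_min e0.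
  by move=> v [Vv]; rewrite lt_min => /andP[].
have Fl : cvg F.
  apply: cauchy_cvg; apply/cauchy_ballP => e e0.
  have d0 : 0 < c * (e / 2) by rewrite mulr_gt0// divr_gt0.
  exists (near_x (c * (e / 2)), near_x (c * (e / 2))).
    by split; exists (c * (e / 2)).
  move=> [u v] [/= [Vu xu] [Vv xv]]; rewrite -ball_normE /=.
  rewrite -(ltr_pM2l c0).
  apply: le_lt_trans (Gc _ _) _.
    by have -> : u - v = (-1) *: v + u by [rewrite scaleN1r addrC]; exact: VD.
  have -> : G (u - v) = (x - G v) - (x - G u).
    by rewrite linearB opprB addrCA addrAC subrr add0r.
  by apply: le_lt_trans (ler_normB _ _) _; lra.
pose l := lim F.
have lx e : 0 < e -> exists v, [/\ V v, `|x - G v| < e & `|l - v| < e].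
  move=> e0; have Fe : F (near_x e) by exists e.
  have Fb : F (ball l e) by apply: Fl; exact: nbhsx_ballx.
  have [v [[Vv xv] lv]] := filter_ex (filterI Fe Fb).
  by exists v; split=> //; move: lv; rewrite -ball_normE.
have Vl : V l.
  apply: clV => B /nbhs_ballP[e /= e0 lB]; have [v [Vv _ lv]] := lx e e0.
  by exists v; split=> //; apply: lB; rewrite -ball_normE.
apply: (nx l Vl); apply/eqP; rewrite eq_sym -subr_eq0 -normr_le0.
apply/ler_addgt0Pl => e e0; rewrite addr0.
pose k := e / (`|G| + 2).
have G2 : 0 < `|G| + 2 by rewrite ltr_wpDl.
have k0 : 0 < k by rewrite divr_gt0.
have kE : e = `|G| * k + 2 * k by rewrite -mulrDl mulrC divfK ?gt_eqF.
have [v [Vv xv lv]] := lx k k0.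
have -> : x - G l = (x - G v) - G (l - v).
  by rewrite linearB opprB addrA subrK.
rewrite (le_trans (ler_normB _ _))//.
have := le_op_norm G (l - v); rewrite -[op_norm G]/`|G| => Glv.
have : `|G| * `|l - v| <= `|G| * k by rewrite ler_wpM2l// ltW.
lra.
Qed.

(** The Riesz lemma for the closed proper subspace G(V). The bounds 2 and 1
    do not depend on G, which is what makes the constants of
    [bounded_below_finite_rank] uniform. *)
Lemma ex_gap_vector G V c x : closed V -> linear_subspace V ->
  bounded_below V c G -> (forall v, V v -> G v <> x) ->
  exists2 y, `|y| <= 2 & forall v, V v -> 1 <= `|y - G v|.
Proof.
move=> clV V_sub Gc nx; have [e e0 xe] := closed_range_gap clV V_sub Gc nx.
have [V0 VD] := V_sub.
pose D := [set `|x - G v| | v in V]; pose d := inf D.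
have D0 : D !=set0 by exists `|x - G 0|, 0.
have De : lbound D e by move=> _ [v Vv <-]; exact: xe.
have Dinf : has_inf D by split=> //; exists e.
have d0 : 0 < d by apply: lt_le_trans e0 _; exact: lb_le_inf.
have [_ [v0 Vv0 <-] v0d] := inf_adherent d0 Dinf.
exists (d^-1 *: (x - G v0)) => [|v Vv].
  by rewrite normrZ gtr0_norm ?invr_gt0// ler_pdivrMl// /d; move: v0d; rewrite -/d; lra.
have -> : d^-1 *: (x - G v0) - G v = d^-1 *: (x - G (d *: v + v0)).
  rewrite linearP opprD [in RHS]addrCA [in RHS]scalerDr [RHS]addrC.
  by rewrite [in RHS]scalerN scalerA mulVf ?gt_eqF// scale1r.
rewrite normrZ gtr0_norm ?invr_gt0// ler_pdivlMl// mulr1.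
apply: (ge_inf (proj2 Dinf)); exists (d *: v + v0) => //; exact: VD.
Qed.

Definition surjective T := forall y, exists x, T x = y.

Definition topological_iso T := surjective T /\ exists c, bounded_below setT c T.

(** T is bounded below by c / 2. If it were not onto, a gap vector y with
    |y| <= 2 would be U u for some |u| <= 2 / c, but then T u is at distance
    less than 1 from y. *)
Lemma topological_iso_perturb U T c : surjective U -> bounded_below setT c U ->
  `|U - T| < c / 2 -> topological_iso T.
Proof.
move=> Usurj [c0 Uc] UT.
have T2 : bounded_below setT (c / 2) T.
  split=> [|f _]; first by rewrite divr_gt0.
  have := Uc f I; have := le_op_norm (U - T) f; rewrite -[op_norm _]/`|U - T| bopB.
  have := ler_normD (U f - T f) (T f); rewrite subrK.
  have : `|U - T| * `|f| <= c / 2 * `|f| by rewrite ler_wpM2r// ltW.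
  lra.
split; last by exists (c / 2).
move=> x; apply: contrapT => /forallNP nx.
have [||//|y y2 yT] := ex_gap_vector (V := setT) (x := x) _ _ T2.
- exact: closedT.
- by split.
have [u uy] := Usurj y; have := Uc u I; have := yT u I; rewrite -uy.
have := le_op_norm (U - T) u; rewrite -[op_norm _]/`|U - T| bopB.
move: y2; rewrite -uy => u2 UTu uT1 cu.
have : `|U - T| * `|u| <= `|U - T| * (2 / c).
  by rewrite ler_wpM2l// ler_pdivlMr// mulrC; lra.
have : `|U - T| * (2 / c) < 1.
  by rewrite mulrA ltr_pdivrMr//; lra.
lra.
Qed.

End closed_range.

(** * Finite-rank perturbations and index 0 *)

Section finite_rank.
Context (R : realType) (X : completeNormedModType R).
Implicit Types (A N U : bounded_operator X).

Definition finite_rank N := exists n (phi : {linear X -> 'rV[R]_n})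
  (L : {linear 'rV[R]_n -> X}), forall f, N f = L (phi f).

Lemma finite_rank0 : finite_rank 0.
Proof.
by exists 0%N, (\0 : {linear X -> _}), (\0 : {linear _ -> X}) => f.
Qed.

Lemma finite_rankN N : finite_rank N -> finite_rank (- N).
Proof.
move=> [n [phi [L NE]]].
by exists n, phi, (GRing.opp \o L : {linear _ -> _}) => f /=; rewrite -NE.
Qed.

Lemma finite_rankD N1 N2 : finite_rank N1 -> finite_rank N2 ->
  finite_rank (N1 + N2).
Proof.
move=> [n1 [phi1 [L1 N1E]]] [n2 [phi2 [L2 N2E]]].
have lphi : linear (fun f => row_mx (phi1 f) (phi2 f)).
  by move=> a f g; rewrite !linearP scale_row_mx add_row_mx.
have lL : linear (fun v : 'rV[R]_(n1 + n2) => L1 (lsubmx v) + L2 (rsubmx v)).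
  by move=> a v w; rewrite !linearP/= scalerDr addrACA.
pose phi : {linear X -> 'rV[R]_(n1 + n2)} :=
  HB.pack (fun f => row_mx (phi1 f) (phi2 f)) (GRing.isLinear.Build _ _ _ _ _ lphi).
pose L : {linear 'rV[R]_(n1 + n2) -> X} :=
  HB.pack (fun v : 'rV[R]_(n1 + n2) => L1 (lsubmx v) + L2 (rsubmx v))
    (GRing.isLinear.Build _ _ _ _ _ lL).
exists (n1 + n2)%N, phi, L => f.
by rewrite bopD N1E N2E /= row_mxKl row_mxKr.
Qed.

Lemma rV_injective_surjective n (T : {linear 'rV[R]_n -> 'rV[R]_n}) :
  (forall v, T v = 0 -> v = 0) <-> (forall w, exists v, T v = w).
Proof.
have TE v : T v = v *m lin1_mx T by rewrite mul_rV_lin1.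
split=> [inj|surj].
  have Tu : lin1_mx T \in unitmx.
    rewrite -row_free_unit -kermx_eq0; apply/eqP/row_matrixP => i.
    by rewrite row0; apply: inj; rewrite TE -row_mul mulmx_ker row0.
  by move=> w; exists (w *m invmx (lin1_mx T)); rewrite TE mulmxKV.
have Tu : lin1_mx T \in unitmx.
  rewrite -row_full_unit -sub1mx; apply/row_subP => i.
  by have [v <-] := surj (row i 1%:M); rewrite TE submxMl.
by move=> v; rewrite TE => /(canRL (mulmxK Tu)); rewrite mul0mx.
Qed.

(** Writing N = L phi and U J = L, the operator U + N is U (1 + J phi), and
    1 + J phi is injective, or surjective, exactly when the matrix 1 + phi J
    is. *)
Lemma finite_rank_perturb_bij U N :
  surjective U -> (forall f, U f = 0 -> f = 0) ->
  finite_rank N ->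
  (forall f, (U + N) f = 0 -> f = 0) <-> surjective (U + N).
Proof.
move=> Usurj Uinj [n [phi [L NE]]].
have /choice[V UV] : forall y, exists x, U x = y by exact: Usurj.
have UB f g : U (f - g) = U f - U g by exact: linearB.
have lV : linear (fun v => V (L v)).
  move=> a v w; apply/eqP; rewrite -subr_eq0; apply/eqP/Uinj.
  by rewrite UB (bop_linear U) !UV linearP subrr.
pose J : {linear 'rV[R]_n -> X} :=
  HB.pack (fun v => V (L v)) (GRing.isLinear.Build _ _ _ _ _ lV).
have UNE f : (U + N) f = U (f + J (phi f)) by rewrite bopD NE linearD /= UV.
pose T : {linear 'rV[R]_n -> 'rV[R]_n} := idfun \+ (phi \o J).
have TE v : T v = v + phi (J v) by [].
have TP := rV_injective_surjective T.
split=> [inj y|surj f].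
  have /TP Tsurj : forall v, T v = 0 -> v = 0.
    move=> v; rewrite TE => Tv.
    have Jv : J v = 0.
      by apply: inj; rewrite UNE -linearD Tv !linear0.
    by move: Tv; rewrite Jv linear0 addr0.
  have [v Tv] := Tsurj (phi (V y)); exists (V y - J v).
  rewrite UNE (_ : phi (V y - J v) = v) ?subrK ?UV//.
  by rewrite linearB/= -Tv TE addrK.
have /TP Tinj : forall w, exists v, T v = w.
  move=> w; have [x xE] := surj (U (J w)); exists (w - phi x).
  have {}xE : x + J (phi x) = J w.
    apply/eqP; rewrite -subr_eq0; apply/eqP/Uinj.
    by rewrite UB -UNE xE subrr.
  by rewrite TE linearB linearB -xE linearD addrK subrK.
rewrite UNE => /Uinj fE.
have pf : phi f = 0 by apply: Tinj; rewrite TE -linearD fE linear0.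
by move: fE; rewrite pf linear0 addr0.
Qed.

(** Equivalent to the usual condition that A be Fredholm of index 0. *)
Definition fredholm_index0 A :=
  exists2 N, finite_rank N & topological_iso (A + N).

Lemma fredholm_index0_inj_surj A : fredholm_index0 A ->
  (forall f, A f = 0 -> f = 0) <-> surjective A.
Proof.
move=> [N Nfin [surj [c Ac]]]; rewrite -(addrK N A).
apply: finite_rank_perturb_bij; [exact: surj|exact: bounded_below_inj Ac|].
exact: finite_rankN.
Qed.

Lemma fredholm_index0D A N : finite_rank N -> fredholm_index0 A ->
  fredholm_index0 (A + N).
Proof.
move=> Nfin [N0 N0fin iso]; exists (N0 - N).
  by apply: finite_rankD => //; exact: finite_rankN.
by rewrite addrACA subrr addr0.
Qed.

End finite_rank.

(** * Stability of index 0 *)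

Section index_stability.
Context (K : compactHausdorffType) (R : realType).
Notation X := (contfun K R).
Implicit Types (A G H N S : bounded_operator X) (F : seq K).

Lemma vanishing_subspace F : linear_subspace (vanishing F : set X).
Proof.
split=> [z _|a f g f0 g0 z zF]; first exact: contfun0.
by rewrite contfunD contfunZ f0// g0// mulr0 addr0.
Qed.

Lemma vanishing_closed F : closed (vanishing F : set X).
Proof.
move=> f clf z zF; apply/eqP; rewrite -normr_le0; apply/ler_addgt0Pl => e e0.
rewrite addr0; have [g [gF]] := clf _ (nbhsx_ballx f _ e0).
rewrite -ball_normE /= => fg; apply: le_trans (ltW fg).
by rewrite -[f z]subr0 -(gF z zF) -contfunB contfun_le_norm.
Qed.

Let eval_tensor_subproof z (y : X) :
  (fun f : X => f z *: y) \in bounded_linear_pred X.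
Proof.
rewrite inE; split=> [a f g|]; first by rewrite contfunD contfunZ scalerDl scalerA.
by exists `|y| => f; rewrite normrZ mulrC ler_wpM2l// contfun_le_norm.
Qed.

Definition eval_tensor z (y : X) : bounded_operator X :=
  BoundedOperator (eval_tensor_subproof z y).

Lemma eval_tensor_finite_rank z y : finite_rank (eval_tensor z y).
Proof.
have lphi : linear (fun f : X => const_mx (f z) : 'rV[R]_1).
  by move=> a f g; apply/rowP => i; rewrite !mxE.
have lL : linear (fun v : 'rV[R]_1 => v 0 0 *: y).
  by move=> a v w; rewrite !mxE scalerDl scalerA.
pose phi : {linear X -> 'rV[R]_1} :=
  HB.pack (fun f : X => const_mx (f z) : 'rV[R]_1)
    (GRing.isLinear.Build _ _ _ _ _ lphi).
pose L : {linear 'rV[R]_1 -> X} :=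
  HB.pack (fun v : 'rV[R]_1 => v 0 0 *: y) (GRing.isLinear.Build _ _ _ _ _ lL).
by exists 1%N, phi, L => f /=; rewrite mxE.
Qed.

(** If e represents the evaluation at z on the functions vanishing on F, send e
    to a gap vector y of the image of the smaller space. The image is proper,
    for otherwise G would be onto, hence injective by index 0, while G e would
    have a preimage other than e. *)
Lemma bounded_below_extend z F c (e : X) G : vanishing F e -> e z = 1 ->
  fredholm_index0 G -> bounded_below (vanishing (z :: F)) c G ->
  exists y, bounded_below (vanishing F) (3 / c + `|e|)^-1
    (G + eval_tensor z (y - G e)).
Proof.
move=> Fe ez Gind Gc; have [c0 _] := Gc.
have vanB f : vanishing F f -> vanishing (z :: F) (f - f z *: e).
  move=> Ff w; rewrite inE contfunB contfunZ => /predU1P[->|wF].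
    by rewrite ez mulr1 subrr.
  by rewrite Ff// Fe// mulr0 subrr.
have [x nx] : exists x, forall v, vanishing (z :: F) v -> G v <> x.
  have [[x nx]|surj] := pselect (exists x, forall v, G v <> x).
    by exists x => v _; exact: nx.
  have Ginj : forall f, G f = 0 -> f = 0.
    apply/(fredholm_index0_inj_surj Gind) => y.
    by apply: contrapT => /forallNP ny; apply: surj; exists y.
  exists (G e) => v vF Gve.
  have /Ginj/eqP : G (v - e) = 0 by rewrite linearB/= Gve subrr.
  rewrite subr_eq0 => /eqP ve; have := vF z (mem_head z F).
  by rewrite ve ez => /eqP; rewrite oner_eq0.
have [y y2 yG] := ex_gap_vector (@vanishing_closed (z :: F))
  (vanishing_subspace (z :: F)) Gc nx.
have k0 : 0 < 3 / c + `|e| by rewrite ltr_wpDr// divr_gt0.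
exists y; split=> [|f Ff]; first by rewrite invr_gt0.
rewrite ler_pdivrMl//; set v := f - f z *: e; have vF : vanishing _ v := vanB f Ff.
have fE : f = v + f z *: e by rewrite subrK.
have GfE : (G + eval_tensor z (y - G e)) f = G v + f z *: y.
  rewrite bopD.
  have -> : G v = G f - f z *: G e by rewrite /v linearB linearZ.
  have -> : eval_tensor z (y - G e) f = f z *: y - f z *: G e.
    by rewrite -scalerBr.
  by rewrite addrA addrAC.
rewrite GfE; set g := G v + _.
(* g is f z times a vector at distance at least 1 from 0, by the choice of y. *)
have fz : `|f z| <= `|g|.
  have [->|fz0] := eqVneq (f z) 0; first by rewrite normr0.
  have -> : g = f z *: (y - G (- (f z)^-1 *: v)).
    by rewrite linearZ/= scaleNr opprK scalerDr scalerA divff// scale1r addrC.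
  rewrite normrZ -[leLHS]mulr1 ler_wpM2l//; apply: yG.
  have [V0 VD] := vanishing_subspace (z :: F).
  by rewrite -[_ *: v]addr0; apply: VD.
have Gv : `|G v| <= 3 * `|g|.
  have -> : G v = g - f z *: y by rewrite addrK.
  rewrite (le_trans (ler_normB _ _))// normrZ.
  have : `|f z| * `|y| <= `|g| * 2 by rewrite ler_pM.
  lra.
rewrite [in leLHS]fE (le_trans (ler_normD _ _))// normrZ mulrDl lerD//.
  by rewrite mulrAC ler_pdivlMr// mulrC (le_trans _ Gv)//; exact: (proj2 Gc).
by rewrite mulrC ler_wpM2l.
Qed.

(** Induction on F, absorbing one point at a time with
    [bounded_below_extend]. The order of quantifiers matters: d is found before
    G, so that it can serve for all operators near a given one. *)
Lemma bounded_below_finite_rank F c : 0 < c -> exists2 d, 0 < d &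
  forall G, fredholm_index0 G -> bounded_below (vanishing F) c G ->
    exists2 N, finite_rank N & bounded_below setT d (G + N).
Proof.
elim: F c => [|z F IH] c c0.
  exists c => // G _ [_ Gc]; exists 0; first exact: finite_rank0.
  by rewrite addr0; split=> // f _; exact: Gc.
(* If every function vanishing on F vanishes at z, adding z changes nothing. *)
have [[e [Fe ez]]|nz] := pselect (exists e : X, vanishing F e /\ e z <> 0).
  pose e1 := (e z)^-1 *: e.
  have e1z : e1 z = 1 by rewrite contfunZ mulVf//; exact/eqP.
  have Fe1 : vanishing F e1 by move=> w wF; rewrite contfunZ (Fe w)// mulr0.
  have [|d d0 dP] := IH (3 / c + `|e1|)^-1.
    by rewrite invr_gt0 ltr_wpDr// divr_gt0.
  exists d => // G Gind Gc.
  have [y Gy] := bounded_below_extend Fe1 e1z Gind Gc.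
  have [|N Nfin GN] := dP _ _ Gy.
    by apply: fredholm_index0D => //; exact: eval_tensor_finite_rank.
  exists (eval_tensor z (y - G e1) + N); last by rewrite addrA.
  by apply: finite_rankD => //; exact: eval_tensor_finite_rank.
have [d d0 dP] := IH c c0; exists d => // G Gind [_ Gc]; apply: dP => //.
split=> // f Ff; apply: Gc => w; rewrite inE => /predU1P[->|/Ff//].
by apply: contrapT => fz; apply: nz; exists f.
Qed.

(** The corrected operator G + N is an isomorphism whose lower bound d is
    uniform in G, so H + N is one as soon as |G - H| < d / 2. *)
Lemma fredholm_index0_near F c : 0 < c -> exists2 d, 0 < d & forall G H,
  fredholm_index0 G -> bounded_below (vanishing F) c G -> `|G - H| < d ->
  fredholm_index0 H.
Proof.
move=> c0; have [d d0 dP] := bounded_below_finite_rank F c0.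
exists (d / 2); first by rewrite divr_gt0.
move=> G H Gind Gc GH; have [N Nfin GN] := dP G Gind Gc.
exists N => //; apply: (topological_iso_perturb _ GN).
  have GNind := fredholm_index0D Nfin Gind.
  exact/(fredholm_index0_inj_surj GNind)/bounded_below_inj/GN.
by rewrite opprD addrACA subrr addr0.
Qed.

(** Both A and the operators near it are bounded below by c / 2, so
    [fredholm_index0_near] applies in both directions. *)
Lemma fredholm_index0_locally_constant A F c :
  bounded_below (vanishing F) c A ->
  exists2 d, 0 < d & forall H, `|A - H| < d ->
    (fredholm_index0 A <-> fredholm_index0 H).
Proof.
move=> [c0 Ac]; have c20 : 0 < c / 2 by rewrite divr_gt0.
have [d d0 dP] := fredholm_index0_near F c20.
exists (Order.min d (c / 2)); first by rewrite lt_min d0.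
move=> H; rewrite lt_min => /andP[AHd AHc]; split=> [Aind|Hind].
  apply: (dP A) => //; split=> // f Ff; apply: le_trans (Ac f Ff).
  by rewrite ler_wpM2r//; lra.
apply: (dP H) => //; last by rewrite -opprB normrN.
split=> // f Ff; have := Ac f Ff; have := le_op_norm (A - H) f.
rewrite -[op_norm _]/`|A - H| bopB.
have := ler_normD (A f - H f) (H f); rewrite subrK.
have : `|A - H| * `|f| <= c / 2 * `|f| by rewrite ler_wpM2r// ltW.
lra.
Qed.

Lemma mult_op_bounded_below (g : X) c : 0 < c -> (forall p, c <= `|g p|) ->
  bounded_below setT c (mult_op g).
Proof.
move=> c0 gc; split=> // f _; rewrite -ler_pdivlMl//.
apply: contfun_norm_le => [|p]; first by rewrite mulr_ge0// invr_ge0 ltW.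
rewrite ler_pdivlMl//; apply: le_trans (contfun_le_norm _ p).
by rewrite mult_opE normrM mulrC ler_wpM2l.
Qed.

(** On an almost kernel of M_g + t S, the operator t S nearly equals - M_g
    and is therefore bounded below. *)
Lemma singular_perturbation_semi_fredholm (g : X) S c t :
  strictly_singular S -> 0 < c -> (forall p, c <= `|g p|) ->
  exists F d, bounded_below (vanishing F) d (mult_op g + t *: S).
Proof.
move=> Sss c0 gc; apply: contrapT => nF; apply: Sss.
have c20 : 0 < c / 2 by rewrite divr_gt0.
have [|Y [Yinf YA]] := ex_almost_kernel (A := mult_op g + t *: S) c20.
  by move=> F d Fd; apply: nF; exists F, d.
have t0 : 0 < `|t| + 1 by rewrite ltr_wpDl.
exists Y; split=> //; apply: (@bounded_below_iso _ _ _ _ (c / 2 / (`|t| + 1))).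
split=> [|f Yf]; first by rewrite divr_gt0.
have gf := (mult_op_bounded_below c0 gc).2 f I.
rewrite mulrAC ler_pdivrMr//.
have := YA f Yf; rewrite bopD bopZ => Af.
have := ler_normB (mult_op g f + t *: S f) (t *: S f); rewrite addrK normrZ.
have := normr_ge0 (S f); rewrite mulrDr mulr1 [`|S f| * _]mulrC; lra.
Qed.

(** The set of t for which M_g + t S has index 0 is clopen in the real line
    and contains 0. *)
Lemma fredholm_index0_singular_perturbation (g : X) S c :
  strictly_singular S -> 0 < c -> (forall p, c <= `|g p|) ->
  fredholm_index0 (mult_op g + S).
Proof.
move=> Sss c0 gc; pose A t : bounded_operator X := mult_op g + t *: S.
have locally_constant t : exists2 d, 0 < d & forall s, `|t - s| < d ->
    (fredholm_index0 (A t) <-> fredholm_index0 (A s)).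
  have [F [d Fd]] := singular_perturbation_semi_fredholm t Sss c0 gc.
  have [e e0 eP] := fredholm_index0_locally_constant Fd.
  have S1 : 0 < `|S| + 1 by rewrite ltr_wpDl.
  exists (e / (`|S| + 1)) => [|s ts]; first by rewrite divr_gt0.
  apply: eP; rewrite /A opprD addrACA subrr add0r -scalerBl normrZ.
  move: ts; rewrite ltr_pdivlMr//; apply: le_lt_trans.
  by rewrite ler_wpM2l// lerDl.
pose I0 : set R := [set t | fredholm_index0 (A t)].
suff I0T : I0 = setT.
  have : I0 1 by rewrite I0T.
  by rewrite /I0/= /A scale1r.
have Rconnected : connected [set: R].
  by apply/connected_intervalP => x y _ _ z _.
apply: Rconnected.
- exists 0; rewrite /I0/= /A scale0r addr0; exists 0; first exact: finite_rank0.
  rewrite addr0; split=> [f|]; last by exists c; exact: mult_op_bounded_below.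
  have g0 p : g p != 0 by rewrite -normr_gt0 (lt_le_trans c0).
  have ch : continuous (fun p => f p / g p).
    move=> p; apply: cvgM; first exact: contfun_continuous.
    by apply: cvgV => //; exact: contfun_continuous.
  exists (mkcts ch : continuousType K R); apply: contfunP => p.
  by rewrite mult_opE [X in X * _]/(f p / g p) divfK.
- exists I0; last by rewrite setTI.
  rewrite openE => t It; have [d d0 dP] := locally_constant t.
  apply: filterS (nbhsx_ballx t _ d0) => s; rewrite -ball_normE => ts.
  exact: (proj1 (dP s ts) It).
- exists I0; last by rewrite setTI.
  move=> t clt; have [d d0 dP] := locally_constant t.
  have [s [Is]] := clt _ (nbhsx_ballx t _ d0); rewrite -ball_normE => ts.
  exact: (proj2 (dP s ts) Is).
Qed.

End index_stability.

(** * Dedekind-finiteness and stable rank *)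

Lemma left_inverse_bounded_below (R : realType) (X : normedModType R)
    (a b : bounded_operator X) :
  b * a = 1 -> bounded_below setT (`|b| + 1)^-1 a.
Proof.
move=> ba; have b1 : 0 < `|b| + 1 by rewrite ltr_wpDl.
split=> [|f _]; first by rewrite invr_gt0.
rewrite ler_pdivrMl//; have {1}-> : f = b (a f) by rewrite -bopM ba.
by rewrite (le_trans (le_op_norm _ _))// ler_wpM2r// lerDl.
Qed.

Lemma connected_sign_change (K : compactHausdorffType) (R : realType)
    (h : contfun K R) p q : connected [set: K] -> h p < 0 -> 0 < h q ->
  exists r, h r = 0.
Proof.
move=> Kconn hp hq.
have /connected_intervalP hK : connected (range h).
  apply: connected_continuous_connected => //.
  by apply: continuous_subspaceT; exact: contfun_continuous.
have [|||r _ hr] := hK (h p) (h q) _ _ 0; [by exists p|by exists q| |by exists r].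
by rewrite !ltW.
Qed.

Theorem proposition2p28 (R : realType) (K : compactHausdorffType)
    (K_connected : connected [set: K]) (K_koszmider : koszmider_space K R) :
  dedekind_finite (bounded_operator (contfun K R)) /\
  ~ stable_rank_one (fun T : bounded_operator (contfun K R) => `|T|).
Proof.
have [K_infinite weak] := K_koszmider; split.
  move=> p _ [a [b [<- ba]]]; have [g [S [Sss aE]]] := weak a.
  have [c0 ac] := left_inverse_bounded_below ba.
  have gc := bounded_below_mult_op_unit K_connected K_infinite Sss.
  have a_inj f : a f = 0 -> f = 0.
    exact: bounded_below_inj (left_inverse_bounded_below ba) f.
  have /fredholm_index0_inj_surj[/(_ a_inj) a_surj _] : fredholm_index0 a.
    rewrite aE; apply: (fredholm_index0_singular_perturbation Sss c0).
    by apply: gc; rewrite -aE.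
  apply: bopP => f; have [x <-] := a_surj f.
  by rewrite -bopM -mulrA ba mulr1.
(* Two distinct points, and g with g p = 1 and g q = -1. *)
have [p _] : [set: K] !=set0.
  by apply/set0P/eqP => K0; apply: K_infinite; rewrite K0.
have [q _ /[!inE]/eqP qp] : exists2 q, [set: K] q & q \notin [:: p].
  by apply: (open_not_finite K_connected K_infinite) openT _; exists p.

have [||f [fp fq]] := @ex_contfun_separating K R [set q] p.
- exact: finite_closed.
- by move=> /= pq; apply: qp.
have cg : continuous (fun x => 2 * f x - 1).
  move=> x; apply: cvgB; last exact: cvg_cst.
  by apply: cvgM; [exact: cvg_cst|exact: contfun_continuous].
pose g : contfun K R := mkcts cg : continuousType K R.
have gE x : g x = 2 * f x - 1 by [].
have gp : g p = 1 by rewrite gE fp; ring.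
have gq : g q = - 1 by rewrite gE fq//; ring.
move=> /(_ (mult_op g) 2^-1); rewrite invr_gt0 ltr0n => /(_ isT).
move=> [U [[V [_ VU]]]]; have [h [S [Sss UE]]] := weak U => gU.
have gh r : `|g r - h r| < 1 / 2.
  have -> : g r - h r = (g - h) r by [].
  apply: le_lt_trans (mult_op_quotient_norm K_connected K_infinite (g - h) Sss r) _.
  rewrite mul1r (_ : _ - S = mult_op g - U)// UE opprD addrA; congr (_ - _).
  by apply: bopP => u; apply: contfunP => x; rewrite bopB contfunB !mult_opE contfunB mulrBr.
have := left_inverse_bounded_below VU; rewrite UE => Uc.
have [c0 _] := Uc.
have [||r hr] := @connected_sign_change K R h q p K_connected.
- by have := gh q; rewrite gq ltr_distl => /andP[]; lra.
- by have := gh p; rewrite gp ltr_distl => /andP[]; lra.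
have := bounded_below_mult_op_unit K_connected K_infinite Sss Uc r.
by rewrite hr normr0 leNgt c0.
Qed.
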